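(* Let $\Omega$ be a linear functional on $\mathbb{C}_{2N}[\lambda]$. In order for $\Omega$ to be the generalized spectral function of some Jacobi matrix $J$ with entries $a_n,b_n\in\mathbb{C}$, $a_n\ne0$, it is necessary and sufficient that the following conditions be satisfied: (i) $\langle\Omega,1\rangle=1$; (ii) if, for some polynomial $G(\lambda)$ with complex coefficients and $\deg G(\lambda)\le N-1$, one has $\langle\Omega,G(\lambda)H(\lambda)\rangle=0$ for all polynomials $H(\lambda)$ with complex coefficients and $\deg H(\lambda)=\deg G(\lambda)$, then $G(\lambda)\equiv0$; (iii) there exists a polynomial $T(\lambda)$ with complex coefficients of degree $N$ such that $\langle\Omega,G(\lambda)T(\lambda)\rangle=0$ for all polynomials $G(\lambda)$ with complex coefficients and $\deg G(\lambda)\le N$.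
   Context: $N$ is a positive integer. A (complex) Jacobi matrix $J$ here is an $N\times N$ symmetric tridiagonal matrix (rows and columns indexed $0,\dots,N-1$) with diagonal entries $b_0,\dots,b_{N-1}\in\mathbb{C}$, with nonzero entries $a_n\in\mathbb{C}$ in positions $(n,n+1)$ and $(n+1,n)$ for $0\le n\le N-2$, and zeros elsewhere. Put $a_{N-1}=1$. The polynomials $P_0(\lambda),\dots,P_N(\lambda)$ associated with $J$ are defined by $P_0(\lambda)=1$, $b_0P_0(\lambda)+a_0P_1(\lambda)=\lambda P_0(\lambda)$, $a_{n-1}P_{n-1}(\lambda)+b_nP_n(\lambda)+a_nP_{n+1}(\lambda)=\lambda P_n(\lambda)$ for $n\in\{1,\dots,N-1\}$. $\mathbb{C}_m[\lambda]$ is the space of polynomials of degree $\le m$ with complex coefficients; $\langle\Omega,G(\lambda)\rangle$ denotes the value of the linear functional $\Omega$ at $G$. The generalized spectral function of $J$ is the unique linear functional $\Omega:\mathbb{C}_{2N}[\lambda]\to\mathbb{C}$ such that $\langle\Omega,P_mP_n\rangle=\delta_{mn}$ for $m,n\in\{0,\dots,N-1\}$ and $\langle\Omega,P_mP_N\rangle=0$ for $m\in\{0,\dots,N\}$. *)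

(* Defs.v *)
From HB Require Import structures.
From mathcomp Require Import all_boot all_order all_algebra.
From mathcomp Require Import reals complex.

Set Implicit Arguments.
Unset Strict Implicit.
Unset Printing Implicit Defensive.

Import GRing.Theory.
Local Open Scope ring_scope.

Definition is_jacobi (F : fieldType) (N : nat) (J : 'M[F]_N) : Prop :=
  [/\ J^T = J,
      forall i j : 'I_N, (i.+1 < j)%N -> J i j = 0 &
      forall i j : 'I_N, j = i.+1 :> nat -> J i j != 0].

(* Entry of J at natural-number indices, 0 out of range. *)
Definition entry (F : fieldType) (N : nat) (J : 'M[F]_N) (i j : nat) : F :=
  match insub i, insub j with
  | Some i', Some j' => J i' j'
  | _, _ => 0
  end.

Definition jac_b (F : fieldType) (N : nat) (J : 'M[F]_N) (n : nat) : F :=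
  entry J n n.

(* The off-diagonal entries a_n, n < N-1, extended by a_(N-1) = 1. *)
Definition jac_a (F : fieldType) (N : nat) (J : 'M[F]_N) (n : nat) : F :=
  if (n.+1 < N)%N then entry J n n.+1 else 1.

(* The three-term recurrence, solved for its last term; see jac_polyP.
   Only the values at n <= N are meaningful. *)
Fixpoint jac_poly (F : fieldType) (N : nat) (J : 'M[F]_N) (n : nat)
    {struct n} : {poly F} :=
  if n is m.+1 then
    (jac_a J m)^-1 *:
      (('X - (jac_b J m)%:P) * jac_poly J m
       - (if m is k.+1 then jac_a J k *: jac_poly J k else 0))
  else 1.

Lemma jac_a_neq0 (F : fieldType) (N : nat) (J : 'M[F]_N) (n : nat) :
  is_jacobi J -> jac_a J n != 0.
Proof.
case=> _ _ Jn0; rewrite /jac_a; case: ltnP => [ltnN|_]; last exact: oner_neq0.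
rewrite /entry (insubT (fun k => k < N)%N (ltnW ltnN)).
by rewrite (insubT (fun k => k < N)%N ltnN) Jn0.
Qed.

Lemma jac_polyP (F : fieldType) (N : nat) (J : 'M[F]_N) :
  is_jacobi J ->
  [/\ jac_poly J 0 = 1,
      jac_b J 0 *: jac_poly J 0 + jac_a J 0 *: jac_poly J 1 =
        'X * jac_poly J 0 &
      forall n, (0 < n < N)%N ->
        jac_a J n.-1 *: jac_poly J n.-1 + jac_b J n *: jac_poly J n
        + jac_a J n *: jac_poly J n.+1 = 'X * jac_poly J n].
Proof.
move=> jJ.
have recE n (p q : {poly F}) : q + jac_a J n *:
    ((jac_a J n)^-1 *: (('X - (jac_b J n)%:P) * p - q))
    = 'X * p - jac_b J n *: p.
  rewrite scalerA divff ?jac_a_neq0 // scale1r mulrBl mul_polyC.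
  by rewrite addrC subrK.
split=> // [|[//|n] _].
  by rewrite addrC -[X in X + _]add0r (recE 0 1 0) subrK.
by rewrite addrAC [X in X + _](recE n.+1 (jac_poly J n.+1)) subrK.
Qed.

(* <Omega, G> for Omega a linear functional on the space of polynomials of
   degree <= M.  npolyp truncates G, so this is meaningful only for
   deg G <= M, i.e. size G <= M.+1. *)
Definition pairing (F : fieldType) (M : nat)
    (Omega : {scalar {poly_M.+1 F}}) (G : {poly F}) : F :=
  Omega (npolyp M.+1 G).

Definition spectral_conditions (F : fieldType) (N : nat) (J : 'M[F]_N)
    (Omega : {scalar {poly_(2 * N).+1 F}}) : Prop :=
  (forall m n, (m < N)%N -> (n < N)%N ->
     pairing Omega (jac_poly J m * jac_poly J n) = (m == n)%:R) /\
  (forall m, (m <= N)%N ->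
     pairing Omega (jac_poly J m * jac_poly J N) = 0).

Definition is_spectral_function (F : fieldType) (N : nat) (J : 'M[F]_N)
    (Omega : {scalar {poly_(2 * N).+1 F}}) : Prop :=
  spectral_conditions J Omega /\
  forall Omega' : {scalar {poly_(2 * N).+1 F}},
    spectral_conditions J Omega' -> Omega' =1 Omega.

(* Main.v *)
(* Necessity: if p_0, ..., p_(N-1) are orthonormal with deg p_n = n, and
   deg G = n < N, then <Omega, G p_n> is the leading coordinate of G in the
   basis (p_k), hence nonzero; and T = p_N satisfies (iii).
   Sufficiency: run the three-term recurrence (Stieltjes procedure).  Writing
   g_n for the n-th polynomial before normalization, (ii) says exactly that
   <Omega, g_n^2> <> 0 for n < N, so that g_n can be normalized with a complex
   square root, and the orthogonality of g_n to all lower degrees propagates.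
   By (ii) again g_N is proportional to T, hence orthogonal to all degrees up
   to N.  Uniqueness of the functional holds since the products p_m p_n with
   m = k/2 and n = k - m, k <= 2N, form a basis of the polynomials of degree at
   most 2N. *)
Require Import Defs.
From HB Require Import structures.
From mathcomp Require Import all_boot all_order all_algebra.
From mathcomp Require Import reals complex.

Set Implicit Arguments.
Unset Strict Implicit.
Unset Printing Implicit Defensive.

Import GRing.Theory Num.Theory.
Local Open Scope ring_scope.

(** * Pairings as linear forms on all polynomials *)

(** Truncation is linear, so the arguments below can use linear forms on [{poly F}] without degree
    bounds. *)
Lemma pairing_is_linear (F : fieldType) (M : nat)
    (Omega : {scalar {poly_M.+1 F}}) : scalar (pairing Omega).
Proof.
move=> c p q; rewrite /pairing -linearP; congr (Omega _).
apply: val_inj => /=; apply/polyP=> i.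
by rewrite !(coef_npolyp, coefD, coefZ); case: ltnP; rewrite // mulr0 addr0.
Qed.

HB.instance Definition _ (F : fieldType) (M : nat)
    (Omega : {scalar {poly_M.+1 F}}) :=
  GRing.isLinear.Build F {poly F} F *%R (pairing Omega)
    (pairing_is_linear Omega).

(** * Families with one polynomial in each degree *)

Section GradedFamilies.
Variable F : fieldType.
Implicit Types (p e q : {poly F}) (L : {scalar {poly F}}).

Lemma lead_coord_neq0 n e : size e = n.+1 -> e`_n != 0.
Proof.
by move=> se; rewrite -[n]/(n.+1.-1) -se lead_coef_eq0 -size_poly_eq0 se.
Qed.

Lemma size_sub_lead n e q : size e = n.+1 -> (size q <= n.+1)%N ->
  (size (q - (q`_n / e`_n) *: e)%R <= n)%N.
Proof.
move=> se sq; apply/leq_sizeP => j; rewrite leq_eqVlt coefB coefZ.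
case/predU1P=> [<-|ltnj]; first by rewrite divfK ?lead_coord_neq0 // subrr.
have {}sq := leq_trans sq ltnj.
by rewrite [q`_j]nth_default // [e`_j]nth_default ?se // mulr0 subr0.
Qed.

(** One elimination step: [c] will be a ratio of leading coefficients, so that [size_sub_lead]
    bounds the remainder. *)
Lemma linear_peel L p e q c :
  L (p * q) = L (p * (q - c *: e)) + c * L (p * e).
Proof. by rewrite -linearZ /= scalerAr -linearD -mulrDr subrK. Qed.

(** The [e k] form a triangular basis; the top coefficient is eliminated by induction. The factor
    [p] serves orthogonality, and [p = 1] serves uniqueness. *)
Lemma graded_family_vanish L p (e : nat -> {poly F}) m q :
    (forall k, (k < m)%N -> size (e k) = k.+1) ->
    (forall k, (k < m)%N -> L (p * e k) = 0) ->
  (size q <= m)%N -> L (p * q) = 0.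
Proof.
elim: m q => [|m IHm] q se Le sq.
  by move: sq; rewrite size_poly_leq0 => /eqP->; rewrite mulr0 linear0.
rewrite (linear_peel _ _ (e m) _ (q`_m / (e m)`_m)) Le // mulr0 addr0.
rewrite IHm ?size_sub_lead ?se // => k ltkm.
- by rewrite se // ltnW.
- by rewrite Le // ltnW.
Qed.

End GradedFamilies.

Lemma size_jac_poly (F : fieldType) (N : nat) (J : 'M[F]_N) n :
  is_jacobi J -> size (jac_poly J n) = n.+1.
Proof.
move=> jJ; elim/ltn_ind: n => -[|n] IHn; first by rewrite /= size_poly1.
rewrite /= size_scale ?invr_eq0 ?jac_a_neq0 //.
have sX : size (('X - (jac_b J n)%:P) * jac_poly J n) = n.+2.
  by rewrite size_monicM ?monicXsubC ?size_XsubC // -?size_poly_eq0 IHn.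
rewrite size_polyDl // sX size_polyN.
case: n IHn {sX} => [|n] IHn; first by rewrite size_poly0.
by rewrite (leq_ltn_trans (size_scale_leq _ _)) // IHn.
Qed.

(** * Uniqueness of the functional and necessity of the conditions *)

Section Spectral.
Variables (F : fieldType) (N : nat) (J : 'M[F]_N).
Hypothesis jJ : is_jacobi J.
Variable Omega : {scalar {poly_(2 * N).+1 F}}.
Hypothesis sO : spectral_conditions J Omega.

Lemma spectral_conditions_unique (Omega' : {scalar {poly_(2 * N).+1 F}}) :
  spectral_conditions J Omega' -> Omega' =1 Omega.
Proof.
case: sO => sO1 sO2 [sO1' sO2'] G.
have GE : G = npolyp (2 * N).+1 (val G).
  by apply: val_inj; rewrite /= npolypK // size_npoly.
apply/eqP; rewrite -subr_eq0 {1 2}GE.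
rewrite -[X in X == 0]/((pairing Omega' \- pairing Omega) (val G)).
rewrite -[val G]mul1r; apply/eqP.
(* The two indices add up to [k] and differ by at most one, so the product has degree [k] and both
   indices stay at most [N]. *)
apply: (@graded_family_vanish _ _ _
  (fun k => jac_poly J k./2 * jac_poly J (uphalf k)) (2 * N).+1); last first.
- exact: size_npoly.
- move=> k; rewrite mul1r /= ltnS [X in (_ <= X)%N -> _]mul2n => lek.
  have leuN : (uphalf k <= N)%N by rewrite leq_uphalf_double.
  have lehN : (k./2 <= N)%N.
    by apply: leq_trans leuN; rewrite uphalf_half leq_addl.
  (* Only [k = 2N-1] and [k = 2N] involve P_N. *)
  case: (ltnP (uphalf k) N) => [ltuN|geuN].
    have lthN : (k./2 < N)%N.
      by apply: leq_ltn_trans ltuN; rewrite uphalf_half leq_addl.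
    by rewrite sO1 // sO1' // subrr.
  have -> : uphalf k = N by apply/eqP; rewrite eqn_leq leuN.
  by rewrite sO2 // sO2' // subrr.
- move=> k _; rewrite size_mul -?size_poly_eq0 !size_jac_poly //=.
  by rewrite addnS uphalf_half addnCA addnn odd_double_half.
Qed.

Lemma spectral_nondegenerate (G : {poly F}) : (size G <= N)%N ->
  (forall H : {poly F}, size H = size G -> pairing Omega (G * H) = 0) -> G = 0.
Proof.
case: sO => sO1 _ sG GH; apply/eqP; rewrite -size_poly_eq0.
case sGE: (size G) sG => [//|n] ltnN.
have := GH (jac_poly J n); rewrite sGE size_jac_poly // => /(_ erefl).
rewrite mulrC (linear_peel _ _ (jac_poly J n) _ (G`_n / (jac_poly J n)`_n)).
rewrite /= sO1 // eqxx mulr1 (@graded_family_vanish _ _ _ (jac_poly J) n).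
- rewrite add0r => /eqP; rewrite mulf_eq0 invr_eq0.
  by rewrite !(negPf (lead_coord_neq0 _)) // size_jac_poly.
- by move=> k _; rewrite size_jac_poly.
- by move=> k ltkn; rewrite /= sO1 ?(ltn_trans ltkn) // gtn_eqF.
- by rewrite size_sub_lead ?sGE ?size_jac_poly.
Qed.

Lemma spectral_top_orthogonal (G : {poly F}) : (size G <= N.+1)%N ->
  pairing Omega (G * jac_poly J N) = 0.
Proof.
case: sO => _ sO2 sG.
rewrite mulrC (@graded_family_vanish _ _ _ (jac_poly J) N.+1) // => k ltkN.
- by rewrite size_jac_poly.
- by rewrite mulrC /= sO2.
Qed.

End Spectral.

(** * Sufficiency: the Stieltjes procedure *)

Section Stieltjes.
Variables (C : numClosedFieldType) (L : {scalar {poly C}}).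

(* The pair (p_(n-1), g_n), where p_(-1) = 0 and g_n is a_(n-1) p_n. *)
Fixpoint stieltjes (n : nat) : {poly C} * {poly C} :=
  if n is m.+1 then
    let: (p, g) := stieltjes m in
    let a := sqrtC (L (g * g)) in
    let q := a^-1 *: g in
    (q, ('X - (L ('X * (q * q)))%:P) * q - a *: p)
  else (0, 1).

Definition residual n := (stieltjes n).2.
(* Shifted by one from the paper: opnorm n.+1 is a_n. *)
Definition opnorm n := sqrtC (L (residual n * residual n)).
Definition opoly n := (opnorm n)^-1 *: residual n.
(** The diagonal entry b_n, chosen to make [residual n.+1] orthogonal to [opoly n]. *)
Definition opdiag n := L ('X * (opoly n * opoly n)).

(** The term a_(n-1) p_(n-1), with p_(-1) = 0. *)
Definition recurrence_tail n : {poly C} :=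
  if n is m.+1 then opnorm n *: opoly m else 0.

Lemma residualS n : residual n.+1 =
  ('X - (opdiag n)%:P) * opoly n - recurrence_tail n.
Proof.
case: n => [|n]; rewrite /recurrence_tail /opdiag /opoly /opnorm /residual /=.
  by rewrite scaler0.
by case: (stieltjes n).
Qed.

Variable N : nat.
Hypothesis L1 : L 1 = 1.
Hypothesis Lnondeg : forall G : {poly C}, (size G <= N)%N ->
  (forall H : {poly C}, size H = size G -> L (G * H) = 0) -> G = 0.

Definition orthogonal_of_degree n := size (residual n) = n.+1 /\
  forall q : {poly C}, (size q <= n)%N -> L (residual n * q) = 0.

(** The form is bilinear, so isotropic vectors are possible. But any [H] of degree [n] is a multiple
    of [residual n] plus lower terms, so a zero square would contradict [Lnondeg]. *)
Lemma residual_norm_neq0 n : (n < N)%N -> orthogonal_of_degree n ->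
  L (residual n * residual n) != 0.
Proof.
move=> ltnN [sg og]; apply/eqP => Lgg0; have := sg.
rewrite (@Lnondeg (residual n)) ?sg ?size_poly0 // => H sH.
rewrite (linear_peel _ _ (residual n) _ (H`_n / (residual n)`_n)).
by rewrite Lgg0 mulr0 addr0 og // size_sub_lead ?sH.
Qed.

Lemma opnorm_neq0 n : (n < N)%N -> orthogonal_of_degree n -> opnorm n != 0.
Proof. by move=> ltnN gn; rewrite sqrtC_eq0 residual_norm_neq0. Qed.

Lemma opnormK n : (n < N)%N -> orthogonal_of_degree n ->
  residual n = opnorm n *: opoly n.
Proof.
by move=> ltnN gn; rewrite scalerA divff ?scale1r // opnorm_neq0.
Qed.

Lemma size_opoly n : (n < N)%N -> orthogonal_of_degree n ->
  size (opoly n) = n.+1.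
Proof.
by move=> ltnN gn; rewrite size_scale ?invr_eq0 ?opnorm_neq0 //; case: gn.
Qed.

Lemma opoly_orthogonal n (q : {poly C}) :
    orthogonal_of_degree n -> (size q <= n)%N ->
  L (opoly n * q) = 0.
Proof.
by case=> _ og sq; rewrite -scalerAl linearZ /= og // mulr0.
Qed.

Lemma opoly_normal n : (n < N)%N -> orthogonal_of_degree n ->
  L (opoly n * opoly n) = 1.
Proof.
move=> ltnN gn; rewrite -scalerAl -scalerAr !linearZ /= mulrA -invfM -expr2.
by rewrite sqrtCK mulVf // residual_norm_neq0.
Qed.

Lemma size_recurrence_tail n : (n <= N)%N ->
    (forall m, (m < n)%N -> orthogonal_of_degree m) ->
  (size (recurrence_tail n) <= n)%N.
Proof.
case: n => [|n] ltnN gp; first by rewrite size_poly0.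
by rewrite (leq_trans (size_scale_leq _ _)) // size_opoly //; exact: gp.
Qed.

(** The test polynomial is split into a multiple of p_n, a multiple of p_(n-1), and a rest of degree
    below n-1; each piece is killed for its own reason. *)
Lemma residual_orthogonal n : (n <= N)%N -> orthogonal_of_degree n.
Proof.
elim/ltn_ind: n => -[|n] IHn ltnN.
  split=> [|q]; first exact: size_poly1.
  by rewrite size_poly_leq0 => /eqP->; rewrite mulr0 linear0.
have gn : orthogonal_of_degree n by apply: IHn => //; exact: ltnW.
have sn := size_opoly ltnN gn.
have gp m : (m < n)%N -> orthogonal_of_degree m.
  by move=> ltmn; apply: IHn; [exact: ltnW | exact: ltnW (ltn_trans ltmn _)].
split.
  have sX : size (('X - (opdiag n)%:P) * opoly n) = n.+2.
    by rewrite size_monicM ?monicXsubC ?size_XsubC // -?size_poly_eq0 sn.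
  rewrite residualS size_polyDl // sX size_polyN.
  exact: leqW (size_recurrence_tail (ltnW ltnN) gp).
move=> q sq.
have orth_n : L (residual n.+1 * opoly n) = 0.
  rewrite residualS mulrBl linearB /= -mulrA mulrBl linearB /=.
  rewrite mul_polyC linearZ /=.
  rewrite opoly_normal // mulr1 subrr sub0r.
  case: n ltnN gn gp {IHn sn sq} => [|n] ltnN gn gp /=.
    by rewrite mul0r linear0 oppr0.
  rewrite -scalerAl linearZ /= [X in L X]mulrC.
  rewrite (opoly_orthogonal gn) ?mulr0 ?oppr0 //.
  by rewrite (size_opoly (ltnW ltnN) (gp n _)).
rewrite (linear_peel _ _ (opoly n) _ (q`_n / (opoly n)`_n)) orth_n mulr0 addr0.
move: (q - _) (size_sub_lead sn sq) => r {sq q}.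
case: n ltnN gn gp sn orth_n {IHn} => [|n] ltnN gn gp sn orth_n sr.
  by move: sr; rewrite size_poly_leq0 => /eqP->; rewrite mulr0 linear0.
have ltnN' := ltnW ltnN; have gpn := gp n (ltnSn n).
have sp := size_opoly ltnN' gpn.
have expand (s : {poly C}) : L (residual n.+2 * s) =
    L (opoly n.+1 * ('X * s)) - opdiag n.+1 * L (opoly n.+1 * s)
    - opnorm n.+1 * L (opoly n * s).
  rewrite residualS /= !mulrBl !linearB /= -!mulrA mul_polyC linearZ /=.
  by rewrite -(scalerAl _ (opoly n) s) linearZ [X in L X - _ - _]mulrCA.
rewrite (linear_peel _ _ (opoly n) _ (r`_n / (opoly n)`_n)).
move: (r - _) (size_sub_lead sp sr) => s ss.
(* Moving ['X] onto [s] keeps the degree below that of [opoly n.+1]. *)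
have sXs : (size ('X * s)%R <= n.+1)%N.
  by rewrite (leq_trans (size_polyMleq _ _)) // size_polyX.
rewrite !expand (opoly_orthogonal gn sXs) (opoly_orthogonal gpn ss).
rewrite [L (opoly n.+1 * s)](opoly_orthogonal gn) ?(leq_trans ss) //.
rewrite [L (opoly n.+1 * opoly n)](opoly_orthogonal gn) ?sp //.
rewrite opoly_normal // !mulr0 !subr0 mulr1 add0r.
(* The recurrence solved for ['X * opoly n]: its pairing with [opoly n.+1] is [opnorm n.+1],
   cancelling the subtracted term. *)
rewrite (_ : 'X * opoly n = opnorm n.+1 *: opoly n.+1 + (opdiag n *: opoly n
  + recurrence_tail n)); last first.
  by rewrite -opnormK // residualS mulrBl mul_polyC addrA addrAC !subrK.
rewrite [X in L X]mulrDr linearD /= -scalerAr linearZ /= opoly_normal // mulr1.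
rewrite (opoly_orthogonal gn) ?addr0 ?subrr ?mulr0 //.
rewrite (leq_trans (size_polyD _ _)) // geq_max.
rewrite (leq_trans (size_scale_leq _ _)) ?sp //=.
apply: leqW; apply: size_recurrence_tail (ltnW ltnN') _ => m ltmn.
exact: gp (ltnW ltmn).
Qed.

(** Off the diagonal the larger index is used, because [opnorm n.+1] is a_n. *)
Definition stieltjes_jacobi : 'M[C]_N :=
  \matrix_(i, j) if i == j :> nat then opdiag i
                 else if j == i.+1 :> nat then opnorm j
                 else if i == j.+1 :> nat then opnorm i else 0.
Local Notation J := stieltjes_jacobi.

Lemma stieltjes_is_jacobi : is_jacobi J.
Proof.
split=> [|i j ltij|i j eji].
- apply/matrixP=> i j; rewrite !mxE eq_sym.
  have [->//|_] := eqVneq (i : nat) j.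
  by have [->|//] := eqVneq (i : nat) j.+1; rewrite ltn_eqF // ltnW.
- rewrite mxE ltn_eqF ?(ltn_trans _ ltij) // gtn_eqF //.
  by rewrite ltn_eqF // ltnS ltnW // ltnW.
- rewrite mxE eji ltn_eqF // eqxx -eji.
  exact: opnorm_neq0 (ltn_ord j) (residual_orthogonal (ltnW (ltn_ord j))).
Qed.

Lemma stieltjes_jac_b n : (n < N)%N -> jac_b J n = opdiag n.
Proof. by move=> ltnN; rewrite /jac_b /entry insubT mxE eqxx. Qed.

Lemma stieltjes_jac_a n :
  jac_a J n = if (n.+1 < N)%N then opnorm n.+1 else 1.
Proof.
rewrite /jac_a; case: ltnP => // ltnN.
rewrite /entry (insubT (ltn^~ N) (ltnW ltnN)).
by rewrite (insubT (ltn^~ N) ltnN) mxE /= ltn_eqF // eqxx.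
Qed.

Lemma jac_poly_opoly n : (n < N)%N -> jac_poly J n = opoly n.
Proof.
elim/ltn_ind: n => -[|n] IHn ltnN.
  (* Condition (i) makes the constant 1 already normalized. *)
  by rewrite /opoly /opnorm /residual /= mulr1 L1 sqrtC1 invr1 scale1r.
rewrite [LHS]/= stieltjes_jac_a ltnN stieltjes_jac_b ?(ltnW ltnN) //.
rewrite IHn ?(ltnW ltnN) //.
rewrite [RHS]/opoly residualS /recurrence_tail.
case: n IHn ltnN => // n IHn ltnN.
by rewrite stieltjes_jac_a (ltnW ltnN) IHn // ltnW // ltnW.
Qed.

(** The convention a_(N-1) = 1 leaves the last polynomial unnormalized. *)
Lemma jac_poly_residual n : n.+1 = N -> jac_poly J n.+1 = residual n.+1.
Proof.
move=> nN; have ltnN : (n < N)%N by rewrite -nN.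
rewrite residualS -jac_poly_opoly // [LHS]/= stieltjes_jac_a {1}nN ltnn.
rewrite invr1 scale1r stieltjes_jac_b //; case: n nN ltnN => // n _ ltnN.
by rewrite /= stieltjes_jac_a ltnN jac_poly_opoly // ltnW.
Qed.

(** After matching leading coefficients, [residual N - c *: T] has degree below [N] and is
    orthogonal to everything of its own degree, hence is zero by [Lnondeg]. *)
Lemma residual_top_orthogonal (T : {poly C}) : size T = N.+1 ->
    (forall G : {poly C}, (size G <= N.+1)%N -> L (G * T) = 0) ->
  forall G : {poly C}, (size G <= N.+1)%N -> L (G * residual N) = 0.
Proof.
move=> sT oT G sG; have [sgN ogN] := residual_orthogonal (leqnn N).
set c := (residual N)`_N / T`_N.
have gNE : residual N = c *: T.
  apply/eqP; rewrite -subr_eq0; apply/eqP; apply: Lnondeg => [|H sH].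
    by rewrite size_sub_lead ?sgN.
  have sHN : (size H <= N)%N by rewrite sH size_sub_lead ?sgN.
  rewrite mulrBl linearB /= ogN // -scalerAl linearZ /= [T * H]mulrC.
  by rewrite oT ?mulr0 ?subrr // leqW.
by rewrite gNE -scalerAr linearZ /= oT ?mulr0.
Qed.

End Stieltjes.

Unset Implicit Arguments.

(** * The characterization of spectral functions *)

Theorem theorem2 (R : realType) (N : nat) (N_gt0 : (0 < N)%N)
    (Omega : {scalar {poly_(2 * N).+1 R[i]}}) :
  (exists J : 'M[R[i]]_N, is_jacobi J /\ is_spectral_function J Omega)
  <->
  [/\ pairing Omega 1 = 1,
      (forall G : {poly R[i]}, (size G <= N)%N ->
         (forall H : {poly R[i]}, size H = size G ->
            pairing Omega (G * H) = 0) ->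
         G = 0) &
      (exists T : {poly R[i]}, size T = N.+1 /\
         forall G : {poly R[i]}, (size G <= N.+1)%N ->
           pairing Omega (G * T) = 0)].
Proof.
split=> [[J [jJ [sO _]]]|[O1 Ond [T [sT oT]]]].
  (* Condition (i) is the normalization of P_0 = 1. *)
  split; first by have := sO.1 0 0 N_gt0 N_gt0; rewrite /= mulr1.
    by move=> G; exact: (spectral_nondegenerate jJ sO).
  exists (jac_poly J N); rewrite size_jac_poly //; split=> // G.
  exact: (spectral_top_orthogonal jJ sO).
pose L : {scalar {poly R[i]}} := pairing Omega.
have jJ := stieltjes_is_jacobi (L := L) Ond.
exists (stieltjes_jacobi L N); split=> //.
have gp n : (n < N)%N -> orthogonal_of_degree L n.
  by move=> ltnN; apply: residual_orthogonal Ond _ (ltnW ltnN).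
suff sO : spectral_conditions (stieltjes_jacobi L N) Omega.
  by split=> // Omega' sO'; exact: (spectral_conditions_unique jJ sO sO').
split=> [m n ltmN ltnN|m lemN].
  rewrite !(jac_poly_opoly (L := L) O1) //.
  wlog lemn : m n ltmN ltnN / (m <= n)%N.
    move=> IH; case/orP: (leq_total m n) => [|lenm]; first exact: IH.
    by rewrite mulrC eq_sym IH.
  have [<-|neqmn] := eqVneq m n.
    exact: opoly_normal Ond _ ltmN (gp m ltmN).
  (* The factor of larger degree comes first, as it is orthogonal to all lower degrees. *)
  rewrite mulrC; apply: opoly_orthogonal (gp n ltnN) _.
  by rewrite (size_opoly Ond ltmN (gp m ltmN)) ltn_neqAle neqmn.
have := @jac_poly_residual _ L N O1 N.-1; rewrite prednK // => -> //.
apply: (residual_top_orthogonal (L := L) Ond sT oT).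
by rewrite size_jac_poly.
Qed.
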